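(* Let $\alpha,\beta\in\mathbb R$ and $\sigma_w^2>0$ with $\alpha\neq0$ and $\alpha^2\sigma_w^2+\beta^2>1$. Suppose there is an eigenvector $u$ of $\hat A$ with eigenvalue $1$ such that $X^\top u\neq\mathbf 0_{d_0}$. Then, for the linear-ResGCN covariances $\tilde\Sigma^{(L)}$ and metrics defined in the context, $\lim_{L\to\infty}\mathrm{FSP}_L(\sigma_w^2)=\infty$ and $\lim_{L\to\infty}\mathrm{GEV}_L(\sigma_w^2)=0$.
   Context: Let $\mathcal G=(\mathcal V,\mathcal E)$ be a finite undirected graph with $n$ nodes, adjacency matrix $A$, degree matrix $D=\mathrm{diag}(A\mathbf 1_n)$ with degrees $d_i$, $\tilde A=A+I$, $\tilde D=D+I$, $\hat A=\tilde D^{-1/2}\tilde A\tilde D^{-1/2}$, $\hat L=I-\hat A$. For $H\in\mathbb R^{n\times C}$ with rows $h_i$, $\mathrm{Dir}(H)=\mathrm{tr}(H^\top\hat LH)=\sum_{\{i,j\}\in\mathcal E}\|h_i/\sqrt{1+d_i}-h_j/\sqrt{1+d_j}\|^2$. Let $X\in\mathbb R^{n\times d_0}$ be nonzero and $C\ge1$ an integer. The infinite-width (NNGP) covariances of a linear residual GCN ($X^{(0)}=XW^{(0)}$, $H^{(l)}=\hat AX^{(l-1)}W^{(l)}$, $X^{(l)}=\alpha H^{(l)}+\beta X^{(l-1)}$, i.i.d. zero-mean weights of variance $\sigma_w^2/\text{fan-in}$) are defined by $\tilde\Sigma^{(1)}=\frac{\sigma_w^4}{d_0}\hat AXX^\top\hat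 A$ and $\tilde\Sigma^{(l+1)}=\alpha^2\sigma_w^2\hat A\tilde\Sigma^{(l)}\hat A+\beta^2\tilde\Sigma^{(l)}$. With $H\in\mathbb R^{n\times C}$ having i.i.d. columns $N(\mathbf 0_n,\tilde\Sigma^{(L)})$, define $\mathrm{FSP}_L(\sigma_w^2)=\mathbb E[\|H\|_F^2/\|X\|_F^2]$ and $\mathrm{GEV}_L(\sigma_w^2)=\mathbb E[\mathrm{Dir}(H)/\|H\|_F^2]$. *)

(* Defs.v *)
From HB Require Import structures.
From mathcomp Require Import all_boot all_order all_algebra.
From mathcomp Require Import all_classical all_reals all_analysis.
Set Implicit Arguments. Unset Strict Implicit. Unset Printing Implicit Defensive.
Import Order.TTheory GRing.Theory Num.Theory.
Local Open Scope classical_set_scope.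
Local Open Scope ring_scope.

Section GCN.
Variables (R : realType) (n : nat).

(* Simple undirected graph on 'I_n given by a symmetric irreflexive relation e;
   A is its 0/1 adjacency matrix. *)
Definition adj (e : rel 'I_n) : 'M[R]_n := \matrix_(i, j) (e i j)%:R.
Definition degree (e : rel 'I_n) (i : 'I_n) : R := \sum_j adj e i j.
Definition Atilde (e : rel 'I_n) : 'M[R]_n := adj e + 1%:M.
Definition Dtilde_isqrt (e : rel 'I_n) : 'M[R]_n :=
  diag_mx (\row_i (Num.sqrt (1 + degree e i))^-1).
Definition Ahat (e : rel 'I_n) : 'M[R]_n :=
  Dtilde_isqrt e *m Atilde e *m Dtilde_isqrt e.
Definition Lhat (e : rel 'I_n) : 'M[R]_n := 1%:M - Ahat e.

Definition frob2 m k (M : 'M[R]_(m, k)) : R := \sum_i \sum_j M i j ^+ 2.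
Definition Dir (e : rel 'I_n) k (H : 'M[R]_(n, k)) : R :=
  \tr (H^T *m Lhat e *m H).

(* NNGP covariances: Sigma_aux k = \tilde\Sigma^{(k+1)} *)
Fixpoint Sigma_aux (e : rel 'I_n) d0 (X : 'M[R]_(n, d0)) (alpha beta sw2 : R)
    (k : nat) : 'M[R]_n :=
  match k with
  | 0 => (sw2 ^+ 2 / d0%:R) *: (Ahat e *m X *m X^T *m Ahat e)
  | k'.+1 => let S := Sigma_aux e X alpha beta sw2 k' in
      (alpha ^+ 2 * sw2) *: (Ahat e *m S *m Ahat e) + (beta ^+ 2) *: S
  end.
(* \tilde\Sigma^{(L)} for L >= 1 (the value at L = 0 is irrelevant) *)
Definition Sigma (e : rel 'I_n) d0 (X : 'M[R]_(n, d0)) (alpha beta sw2 : R)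
    (L : nat) : 'M[R]_n := Sigma_aux e X alpha beta sw2 L.-1.

Definition std_gaussian_family d (T : measurableType d) (P : probability T R)
    (C : nat) (Z : 'I_n -> 'I_C -> T -> R) : Prop :=
  (forall i j, measurable_fun setT (Z i j)) /\
  (forall i j (B : set R), measurable B ->
      P (Z i j @^-1` B) = normal_prob 0 1 B) /\
  (forall B : 'I_n -> 'I_C -> set R, (forall i j, measurable (B i j)) ->
      P (\bigcap_(k in [set: 'I_n * 'I_C]) (Z k.1 k.2 @^-1` B k.1 k.2))%classic
      = (\prod_(k : 'I_n * 'I_C) P (Z k.1 k.2 @^-1` B k.1 k.2))%E).

Definition Zmat d (T : measurableType d) C (Z : 'I_n -> 'I_C -> T -> R) (t : T)
  : 'M[R]_(n, C) := \matrix_(i, j) Z i j t.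

(* H = S Z : if S S^T = Sigma, the columns of H are i.i.d. N(0, Sigma). *)
Definition FSP d (T : measurableType d) (P : probability T R) C
    (Z : 'I_n -> 'I_C -> T -> R) (S : 'M[R]_n) d0 (X : 'M[R]_(n, d0)) : \bar R :=
  ('E_P[fun t => (frob2 (S *m Zmat Z t) / frob2 X)%R])%E.
Definition GEV (e : rel 'I_n) d (T : measurableType d) (P : probability T R) C
    (Z : 'I_n -> 'I_C -> T -> R) (S : 'M[R]_n) : \bar R :=
  ('E_P[fun t => (Dir e (S *m Zmat Z t) / frob2 (S *m Zmat Z t))%R])%E.

End GCN.

Arguments adj {R n}. Arguments degree {R n}. Arguments Atilde {R n}.
Arguments Dtilde_isqrt {R n}. Arguments Ahat {R n}. Arguments Lhat {R n}.
Arguments Dir {R n} e {k}. Arguments Sigma {R n} e {d0}. Arguments Sigma_aux {R n} e {d0}.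

(* Main.v *)
(* The proof uses neither moments nor the spectral theorem.

   Deterministic part.  Write Sigma^(k+1) = G_k G_k^T, a = alpha^2 sw2,
   b = beta^2 and rho = a + b > 1.  Pairing with the eigenvector u gives
   ||u^T G_k||^2 = rho^k ||u^T G_0||^2.  The self-loops keep the spectrum of Ahat
   in [-1 + gap, 1], whence gap * Dir(G) <= ||G||^2 - ||Ahat G||^2.  So
   ||G_k||^2 / rho^k is nonincreasing and its decrements dominate Dir(G_k) / rho^k,
   which therefore tends to 0.

   Probabilistic part.  A linear form in independent standard Gaussians satisfies
   |<w, Y>| >= delta |w| off an event of small probability, uniformly in w.  Off
   such an event ||G_k Z||^2 >= c rho^k, which yields FSP -> oo, while
   Dir(G_k Z) <= Dir(G_k) ||Z||^2 = o(rho^k), which yields GEV -> 0, the ratio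
   being bounded by 2 on the exceptional event. *)

Require Import Defs.
From HB Require Import structures.
From mathcomp Require Import all_boot all_order all_algebra.
From mathcomp Require Import all_classical all_reals all_analysis.
From mathcomp Require Import measurable_realfun ring lra.
Import Order.TTheory GRing.Theory Num.Theory.
Import numFieldNormedType.Exports.
Local Open Scope classical_set_scope.
Local Open Scope ring_scope.

(** * Dirichlet energy and propagation *)

(** Cauchy-Schwarz by Lagrange's identity: the sum of all squared 2x2 minors is twice the defect. *)
Lemma sum_mul_sqr_le {R : realType} {I : finType} (a b : I -> R) :
  (\sum_i a i * b i) ^+ 2 <= (\sum_i a i ^+ 2) * (\sum_i b i ^+ 2).
Proof.
have H : 0 <= \sum_i \sum_j (a i * b j - a j * b i) ^+ 2.
  by apply: sumr_ge0 => i _; apply: sumr_ge0 => j _; exact: sqr_ge0.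
suff E : \sum_i \sum_j (a i * b j - a j * b i) ^+ 2 =
    ((\sum_i a i ^+ 2) * (\sum_i b i ^+ 2) - (\sum_i a i * b i) ^+ 2) *+ 2.
  by move: H; rewrite E pmulrn_lge0// subr_ge0.
rewrite mulr2n {1}(mulrC (\sum_i a i ^+ 2)) expr2 !big_distrlr /= -!sumrB -big_split /=.
apply: eq_bigr => i _; rewrite -!sumrB -big_split /=.
by apply: eq_bigr => j _; ring.
Qed.

Section Frobenius.
Context {R : realType}.

Lemma frob2_ge0 {m k} (M : 'M[R]_(m, k)) : 0 <= frob2 M.
Proof. by apply: sumr_ge0 => i _; apply: sumr_ge0 => j _; exact: sqr_ge0. Qed.

Lemma sqr_le_frob2 {m k} (M : 'M[R]_(m, k)) i j : M i j ^+ 2 <= frob2 M.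
Proof.
rewrite /frob2 (bigD1 i)//= (bigD1 j)//= -addrA lerDl addr_ge0//.
  by apply: sumr_ge0 => ? _; exact: sqr_ge0.
by apply: sumr_ge0 => ? _; apply: sumr_ge0 => ? _; exact: sqr_ge0.
Qed.

Lemma frob2_gt0 {m k} (M : 'M[R]_(m, k)) : M != 0 -> 0 < frob2 M.
Proof.
move=> /matrix0Pn[i [j Mij]].
by apply: lt_le_trans (sqr_le_frob2 M i j); rewrite exprn_even_gt0.
Qed.

Lemma frob2E {m k} (M : 'M[R]_(m, k)) : frob2 M = \tr (M *m M^T).
Proof.
apply: eq_bigr => i _; rewrite mxE; apply: eq_bigr => j _.
by rewrite mxE expr2.
Qed.

Lemma frob2_tr {m k} (M : 'M[R]_(m, k)) : frob2 M^T = frob2 M.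
Proof. by rewrite !frob2E trmxK mxtrace_mulC. Qed.

Lemma frob2M {m k p} (M : 'M[R]_(m, k)) (N : 'M[R]_(k, p)) :
  frob2 (M *m N) <= frob2 M * frob2 N.
Proof.
rewrite -(frob2_tr N) /frob2 big_distrlr /=.
apply: ler_sum => i _; apply: ler_sum => j _; rewrite mxE.
apply: le_trans (sum_mul_sqr_le _ _) _.
by rewrite [X in _ <= _ * X](eq_bigr (fun l => N l j ^+ 2))// => l _; rewrite mxE.
Qed.

(** Symmetry of [M] merges the two cross terms. Used with [M] the Laplacian for the energy and with
    [M] the identity for the norm. *)
Lemma trace_quadBZ {n k} (M : 'M[R]_n) (x y : 'M[R]_(n, k)) (t : R) : M^T = M ->
  \tr ((x - t *: y)^T *m M *m (x - t *: y)) =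
  \tr (x^T *m M *m x) - 2 * t * \tr (x^T *m M *m y) + t ^+ 2 * \tr (y^T *m M *m y).
Proof.
move=> Msym; rewrite [(x - _)^T]raddfB /= [(t *: _)^T]linearZ /= !mulmxBl !mulmxBr.
rewrite -!scalemxAl -!scalemxAr !raddfB /= !mxtraceZ.
rewrite -(mxtrace_tr (y^T *m M *m x)) !trmx_mul !trmxK Msym mulmxA; ring.
Qed.

End Frobenius.

(** * Edge decomposition and spectral gap of the normalized adjacency matrix *)

Section Laplacian.
Context {R : realType} {n : nat} (e : rel 'I_n).
Hypothesis e_sym : symmetric e.

Let s (i : 'I_n) : R := (Num.sqrt (1 + degree e i))^-1.
Let ee (i j : 'I_n) : R := (e i j)%:R.

Lemma degreeE i : degree e i = \sum_j ee i j :> R.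
Proof. by apply: eq_bigr => j _; rewrite mxE. Qed.

Lemma degree_ge0 i : 0 <= degree e i :> R.
Proof. by rewrite degreeE; apply: sumr_ge0 => j _; rewrite ler0n. Qed.

Lemma degree_le i : degree e i <= n%:R :> R.
Proof.
rewrite degreeE -[leRHS](_ : \sum_(j < n) 1 = _); last first.
  by rewrite sumr_const card_ord.
by apply: ler_sum => j _; rewrite /ee lern1 leq_b1.
Qed.

Lemma isqrt_sqrM i : s i ^+ 2 * (1 + degree e i) = 1.
Proof.
have d_gt0 : 0 < 1 + degree e i :> R by rewrite ltr_pwDl// degree_ge0.
by rewrite /s exprVn sqr_sqrtr ?ltW// mulVf// gt_eqF.
Qed.

Lemma AhatE i j : Ahat e i j = s i * (ee i j + (i == j)%:R) * s j.
Proof.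
rewrite /Ahat /Dtilde_isqrt mul_mx_diag mxE mul_diag_mx !mxE -/(s i) -/(s j); ring.
Qed.

Lemma Ahat_sym : (Ahat e)^T = Ahat e :> 'M[R]_n.
Proof.
apply/matrixP => i j; rewrite mxE !AhatE /ee e_sym eq_sym; ring.
Qed.

(** For one column h, [Eform] and [dform] are the adjacency and degree forms of the rescaled vector
    s h, without self-loops. The self-loops add the same sum of (s_i h_i)^2 to h^T Ahat h and to
    |h|^2, so the Dirichlet energy of h is [dform h - Eform h]. *)
Let Aform (h : 'I_n -> R) := \sum_i \sum_j h i * Ahat e i j * h j.
Let Eform (h : 'I_n -> R) := \sum_i \sum_j ee i j * (s i * h i) * (s j * h j).
Let dform (h : 'I_n -> R) := \sum_i degree e i * (s i * h i) ^+ 2.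

Let AformE h : Aform h = Eform h + \sum_i (s i * h i) ^+ 2.
Proof.
rewrite /Aform /Eform -big_split /=; apply: eq_bigr => i _.
rewrite -[X in _ + X](_ : \sum_j (i == j)%:R * (s i * h i) * (s j * h j) = _).
  by rewrite -big_split /=; apply: eq_bigr => j _; rewrite AhatE; ring.
rewrite (bigD1 i)//= big1 ?eqxx; first by rewrite mul1r addr0 expr2.
by move=> j ij; rewrite eq_sym (negbTE ij) !mul0r.
Qed.

Let sqrE h : \sum_i h i ^+ 2 = dform h + \sum_i (s i * h i) ^+ 2.
Proof.
rewrite -big_split /=; apply: eq_bigr => i _.
transitivity ((s i ^+ 2 * (1 + degree e i)) * h i ^+ 2); last by ring.
by rewrite isqrt_sqrM mul1r.
Qed.

(** The sign b = -1 gives the Laplacian energy, b = 1 the signless one. Ordered pairs count each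
    edge twice. *)
Let edgeE h (b : R) : b ^+ 2 = 1 ->
  \sum_i \sum_j ee i j * (s i * h i + b * (s j * h j)) ^+ 2 =
  (dform h + b * Eform h) *+ 2.
Proof.
move=> b1.
have E1 : dform h = \sum_i \sum_j ee i j * (s i * h i) ^+ 2.
  by apply: eq_bigr => i _; rewrite degreeE big_distrl.
have E2 : dform h = \sum_i \sum_j ee i j * (s j * h j) ^+ 2.
  rewrite E1 exchange_big /=; apply: eq_bigr => i _; apply: eq_bigr => j _.
  by rewrite /ee e_sym.
rewrite mulrnDl mulr2n {1}E1 E2 mulr_sumr -sumrMnl -!big_split /=.
apply: eq_bigr => i _; rewrite mulr_sumr -sumrMnl -!big_split /=.
apply: eq_bigr => j _; transitivity (ee i j * ((s i * h i) ^+ 2 + 2 * b * (s i * h i) * (s j * h j) + b ^+ 2 * (s j * h j) ^+ 2)); first by ring.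
rewrite b1; ring.
Qed.

Lemma DirB {k} (H : 'M[R]_(n, k)) :
  Dir e H = frob2 H - \tr (H^T *m Ahat e *m H).
Proof.
rewrite /Dir /Lhat mulmxBr mulmxBl raddfB /= mulmx1 -(frob2_tr H) frob2E.
by rewrite trmxK.
Qed.

Lemma frob2_col {k} (H : 'M[R]_(n, k)) : frob2 H = \sum_c \sum_i H i c ^+ 2.
Proof. by rewrite /frob2 exchange_big. Qed.

Let traceA {k} (H : 'M[R]_(n, k)) :
  \tr (H^T *m Ahat e *m H) = \sum_c Aform (H^~ c).
Proof.
apply: eq_bigr => c _; rewrite mxE /Aform.
under eq_bigr do rewrite mxE.
under [LHS]eq_bigr do rewrite big_distrl /=.
rewrite exchange_big /=; apply: eq_bigr => i _; apply: eq_bigr => j _.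
by rewrite mxE.
Qed.

(** A row of the rescaled signed incidence matrix, zero off the edges. It turns [Dir] into a sum of
    squared norms of linear images, from which nonnegativity, [DirM] and measurability are inherited
    from [frob2]. *)
Definition edge_row (i j : 'I_n) : 'rV[R]_n :=
  \row_l (ee i j * (s i * (l == i)%:R - s j * (l == j)%:R)).

Lemma edge_rowM i j {k} (H : 'M[R]_(n, k)) c :
  (edge_row i j *m H) 0 c = ee i j * (s i * H i c - s j * H j c).
Proof.
have D (l : 'I_n) : \sum_m (m == l)%:R * H m c = H l c.
  rewrite (bigD1 l)//= eqxx mul1r big1 ?addr0// => m ml.
  by rewrite (negbTE ml) mul0r.
rewrite mxE -(D i) -(D j) !mulr_sumr -sumrB mulr_sumr; apply: eq_bigr => l _.
by rewrite mxE; ring.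
Qed.

Lemma Dir_edges {k} (H : 'M[R]_(n, k)) :
  Dir e H *+ 2 = \sum_i \sum_j frob2 (edge_row i j *m H).
Proof.
have -> : \sum_i \sum_j frob2 (edge_row i j *m H) =
  \sum_c \sum_i \sum_j ee i j * (s i * H i c + -1 * (s j * H j c)) ^+ 2.
  rewrite [RHS]exchange_big /=; apply: eq_bigr => i _.
  rewrite [RHS]exchange_big /=; apply: eq_bigr => j _.
  rewrite /frob2 big_ord1; apply: eq_bigr => c _; rewrite edge_rowM mulN1r.
  by rewrite exprMn /ee; case: (e i j); rewrite ?expr1n// expr0n.
rewrite DirB frob2_col traceA -sumrB -sumrMnl; apply: eq_bigr => c _.
rewrite edgeE ?sqrrN ?expr1n// sqrE AformE; congr (_ *+ 2); ring.
Qed.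

Lemma Dir_ge0 {k} (H : 'M[R]_(n, k)) : 0 <= Dir e H.
Proof.
rewrite -(@pmulrn_lge0 _ _ 2)// Dir_edges.
by do 2![apply: sumr_ge0 => ? _]; exact: frob2_ge0.
Qed.

Lemma DirM {k p} (H : 'M[R]_(n, k)) (N : 'M[R]_(k, p)) :
  Dir e (H *m N) <= Dir e H * frob2 N.
Proof.
rewrite -(@ler_pMn2r _ 2)// -mulrnAl !Dir_edges mulr_suml.
apply: ler_sum => i _; rewrite mulr_suml; apply: ler_sum => j _.
by rewrite mulmxA; exact: frob2M.
Qed.

Let gap : R := 2 / (1 + n%:R).

(* The self-loops keep the spectrum of Ahat at distance gap from -1. *)
Lemma Dir_le {k} (H : 'M[R]_(n, k)) : Dir e H <= (2 - gap) * frob2 H.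
Proof.
rewrite DirB frob2_col traceA -sumrB mulr_sumr; apply: ler_sum => c _.
set h := H^~ c.
(* Per column, twice the squared norm minus the energy equals the signless energy, which is
   nonnegative, plus twice the self-loop term. *)
have E0 : 0 <= dform h + Eform h.
  rewrite -(@pmulrn_lge0 _ _ 2)// -[Eform h]mul1r -edgeE ?expr1n//.
  by do 2![apply: sumr_ge0 => ? _]; rewrite mulr_ge0 ?ler0n ?sqr_ge0.
(* The self-loop term is bounded below because s_i^2 = 1/(1+d_i) and d_i <= n. *)
have S0 : gap * \sum_i h i ^+ 2 <= 2 * \sum_i (s i * h i) ^+ 2.
  rewrite !mulr_sumr; apply: ler_sum => i _.
  rewrite exprMn [leRHS]mulrA; apply: ler_wpM2r; first exact: sqr_ge0.
  rewrite /gap ler_wpM2l// -[leLHS]mul1r.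
  rewrite ler_pdivrMr ?ltr_pwDl// -[leLHS](isqrt_sqrM i).
  by rewrite ler_wpM2l ?sqr_ge0// lerD2l degree_le.
have := sqrE h; rewrite AformE; lra.
Qed.

(** On an eigenvalue x of the Laplacian, which lies in [0, 2 - gap], this reads 1 - (1-x)^2 = x(2-x)
    >= gap x. The proof avoids diagonalization and needs only the quadratic-form bounds [Dir_ge0]
    and [Dir_le]. *)
Lemma frob2B_Ahat {k} (H : 'M[R]_(n, k)) : (0 < n)%N ->
  gap * Dir e H <= frob2 H - frob2 (Ahat e *m H).
Proof.
move=> n0.
have c_gt0 : 0 < 2 - gap.
  have n1 : (1 : R) <= n%:R by rewrite ler1n.
  rewrite subr_gt0 /gap ltr_pdivrMr; last by lra.
  lra.
set c := 2 - gap in c_gt0 *.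
set L : 'M[R]_n := Lhat e.
have Lsym : L^T = L by rewrite /L /Lhat linearB /= trmx1 Ahat_sym.
have DirLH : \tr (H^T *m L *m (L *m H)) = frob2 (L *m H).
  by rewrite -frob2_tr frob2E trmxK trmx_mul Lsym.
have expand (t : R) : Dir e (H - t *: (L *m H)) =
    Dir e H - 2 * t * frob2 (L *m H) + t ^+ 2 * Dir e (L *m H).
  by rewrite /Dir trace_quadBZ// -DirLH mulmxA.
(* The counterpart of x^2 <= c x. Nonnegativity of the energy at H - t L H is used at t = 1/c, the
   minimizer once Dir(L H) is replaced by its bound c |L H|^2. *)
have lo : frob2 (L *m H) <= c * Dir e H.
  have := Dir_ge0 (H - c^-1 *: (L *m H)); rewrite expand => h1.
  have h2 := Dir_le (L *m H); rewrite -/c in h2.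
  have h3 : c^-1 ^+ 2 * Dir e (L *m H) <= c^-1 * frob2 (L *m H).
    apply: le_trans (ler_wpM2l (sqr_ge0 _) h2) _.
    by rewrite expr2 -!mulrA mulKf ?gt_eqF.
  rewrite -ler_pdivrMl//; lra.
have -> : Ahat e *m H = H - 1 *: (L *m H).
  by rewrite scale1r /L /Lhat mulmxBl mul1mx subKr.
have frobB (G : 'M[R]_(n, k)) : frob2 (H - 1 *: G) =
    frob2 H - 2 * \tr (H^T *m G) + frob2 G.
  have tr1 (x y : 'M[R]_(n, k)) : x^T *m y = x^T *m 1%:M *m y by rewrite mulmx1.
  rewrite -(frob2_tr (H - _)) -(frob2_tr H) -(frob2_tr G) !frob2E !trmxK !tr1.
  by rewrite trace_quadBZ ?trmx1// expr1n mulr1 mul1r.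
rewrite frobB mulmxA -/(Dir e H) opprD opprB; rewrite /c in lo; lra.
Qed.

End Laplacian.

(** * Growth of the covariances *)

Section Covariances.
Context {R : realType} {n : nat} (e : rel 'I_n).
Hypothesis e_sym : symmetric e.
Variables (a b : R) (G : nat -> 'M[R]_n).
Hypotheses (a_gt0 : 0 < a) (b_ge0 : 0 <= b).
Hypothesis G_rec : forall k, G k.+1 *m (G k.+1)^T =
  a *: (Ahat e *m (G k *m (G k)^T) *m Ahat e) + b *: (G k *m (G k)^T).

Lemma frob2_rec k :
  frob2 (G k.+1) = a * frob2 (Ahat e *m G k) + b * frob2 (G k).
Proof.
rewrite !frob2E G_rec mxtraceD !mxtraceZ trmx_mul Ahat_sym//.
by rewrite !mulmxA.
Qed.

(** As u is fixed by Ahat on both sides, conjugation by Ahat leaves the form u^T M u unchanged, so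
    both terms of the recursion contribute the same quantity. *)
Lemma frob2_eigen (u : 'cV[R]_n) k : Ahat e *m u = u ->
  frob2 (u^T *m G k) = (a + b) ^+ k * frob2 (u^T *m G 0%N).
Proof.
move=> Au; have uA : u^T *m Ahat e = u^T by rewrite -{1}(Ahat_sym e e_sym) -trmx_mul Au.
elim: k => [|k IH]; first by rewrite expr0 mul1r.
have tr_eigen (M : 'M[R]_n) :
    \tr (u^T *m (Ahat e *m M *m Ahat e) *m u) = \tr (u^T *m M *m u).
  by move: (Ahat e) Au uA => A Au uA; rewrite -!mulmxA Au !mulmxA uA.
have frobE (M : 'M[R]_n) : frob2 (u^T *m M) = \tr (u^T *m (M *m M^T) *m u).
  by rewrite frob2E trmx_mul trmxK !mulmxA.
rewrite exprS -mulrA -IH !frobE G_rec mulmxDr mulmxDl -!scalemxAr -!scalemxAl.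
by rewrite mxtraceD !mxtraceZ tr_eigen mulrDl.
Qed.

Lemma Dir_negligible : (0 < n)%N ->
  (fun k => Dir e (G k) / (a + b) ^+ k) @ \oo --> (0 : R).
Proof.
move=> n0; have rho_gt0 : 0 < a + b by rewrite ltr_pwDl.
set rho := a + b in rho_gt0 *.
have gap_gt0 : 0 < 2 / (1 + n%:R) :> R by rewrite divr_gt0// ltr_pwDl.
set g := 2 / (1 + n%:R) in gap_gt0.
pose t k := frob2 (G k) / rho ^+ k.
(* Substituting b = rho - a makes the decrement (a/rho) times the norm lost under Ahat, divided by
   rho^k; the gap inequality supplies the factor g. *)
have step k : a * g / rho * (Dir e (G k) / rho ^+ k) <= t k - t k.+1.
  have -> : t k - t k.+1 =
      a / rho * ((frob2 (G k) - frob2 (Ahat e *m G k)) / rho ^+ k).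
    rewrite /t frob2_rec exprS.
    have -> : b = rho - a by rewrite /rho; ring.
    by field; rewrite expf_neq0 gt_eqF.
  have := frob2B_Ahat e e_sym (G k) n0; rewrite -/g => h.
  have -> : a * g / rho * (Dir e (G k) / rho ^+ k) =
      a / rho * (g * Dir e (G k) / rho ^+ k) by ring.
  rewrite ler_wpM2l ?divr_ge0 ?(ltW a_gt0) ?(ltW rho_gt0)//.
  by rewrite ler_wpM2r// invr_ge0 exprn_ge0 ?ltW.
have D0 k : 0 <= Dir e (G k) / rho ^+ k.
  by rewrite divr_ge0 ?Dir_ge0// exprn_ge0 ?ltW.
have C0 : 0 < a * g / rho by rewrite !mulr_gt0// invr_gt0.
have cvgt : cvgn t.
  apply: nonincreasing_is_cvgn.
    apply/nonincreasing_seqP => k; rewrite -subr_ge0.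
    by apply: le_trans (step k); rewrite mulr_ge0// ltW.
  exists 0 => _ [k _ <-]; rewrite divr_ge0 ?frob2_ge0// exprn_ge0 ?ltW//.
have tS : (fun k => t k.+1) @ \oo --> limn t.
  by rewrite (cvg_shiftS t).
have dt : (fun k => (a * g / rho)^-1 * (t k - t k.+1)) @ \oo --> (0 : R).
  rewrite -(mulr0 (a * g / rho)^-1) -(subrr (limn t)).
  by apply: cvgMr; apply: cvgB.
apply: (squeeze_cvgr _ (cvg_cst 0) dt).
by near=> k; rewrite D0 /= ler_pdivlMl.
Unshelve. all: by end_near. Qed.

End Covariances.

(** * Anticoncentration of Gaussian linear forms *)

Lemma measure_bigsetU_le {d} {T : measurableType d} {R : realType}
    (P : probability T R) {I : finType} (Q : pred I) (F : I -> set T) :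
  (forall i, measurable (F i)) ->
  (P (\big[setU/set0]_(i | Q i) F i) <= \sum_(i | Q i) P (F i))%E.
Proof.
move=> mF.
suff [] : measurable (\big[setU/set0]_(i | Q i) F i) /\
  (P (\big[setU/set0]_(i | Q i) F i) <= \sum_(i | Q i) P (F i))%E by [].
apply: (big_rec2 (fun A x => measurable A /\ (P A <= x)%E)).
  by rewrite measure0.
move=> i A x _ [mA PA]; split; first exact: measurableU.
by apply: le_trans (measureU2 P (mF i) mA) _; exact: leeD.
Qed.

(** * Interval and tail bounds for the standard normal law *)

Section StdNormal.
Context {R : realType}.
Let nu : probability (measurableTypeR R) R := normal_prob 0 1.

Lemma normal_prob_itv (a b : R) : a <= b ->
  (normal_prob 0 1 `[a, b] <= (normal_peak (1 : R) * (b - a))%:E)%E.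
Proof.
move=> ab; rewrite /normal_prob.
apply: (@le_trans _ _ (\int[lebesgue_measure]_(x in `[a, b]) (cst (normal_peak (1 : R))%:E) x)%E).
  apply: ge0_le_integral => //=.
  - by move=> x _; rewrite lee_fin normal_pdf_ge0.
  - by apply/measurable_EFinP; apply: measurable_funTS; exact: measurable_normal_pdf.
  - by move=> x _; rewrite lee_fin normal_pdf_ub// oner_neq0.
rewrite integral_cst//= lebesgue_measure_itv/= lte_fin EFinM.
rewrite lee_wpmul2l ?lee_fin ?normal_peak_ge0//.
by case: ifPn => _; rewrite ?EFinB// lee_fin subr_ge0.
Qed.

(** Continuity from below along intervals exhausting the line, half-open so that grid cells can tile
    them. *)
Lemma normal_prob_tail (eps : R) : 0 < eps ->
  exists2 K : R, 0 < K & (normal_prob 0 1 (~` `[(- K)%R, K[%classic) <= eps%:E)%E.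
Proof.
move=> eps0; pose F (k : nat) : set R := `[- k.+1%:R, k.+1%:R[%classic.
have cupF : \bigcup_k F k = setT.
  apply/seteqP; split => // x _; exists (Num.bound `|x|) => //=.
  rewrite /F /= in_itv /=.
  have xb : `|x| < (Num.bound `|x|).+1%:R.
    by apply: lt_le_trans (archi_boundP (normr_ge0 x)) _; rewrite ler_nat.
  by move: xb; rewrite ltr_norml => /andP[/ltW -> ->].
have mF k : measurable (F k) by exact: measurable_itv.
have ndF : nondecreasing_seq F.
  move=> m k mk; apply/subsetPset => x; rewrite /F /= !in_itv /= => /andP[h1 h2].
  have mk' : m.+1%:R <= k.+1%:R :> R by rewrite ler_nat.
  by apply/andP; split; lra.
have nuT : nu setT = 1%:E by exact: probability_setT.
have cvF : nu \o F @ \oo --> (1%:E : \bar R).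
  rewrite -nuT -cupF; apply: nondecreasing_cvg_mu => //.
  by rewrite cupF; exact: measurableT.
have eps1 : 1 - eps < fine (1%:E : \bar R) by rewrite /= ltrBlDr ltrDl.
have [k _ /(_ k (leqnn k)) /= Fk] := cvgr_gt _ (fine_cvg cvF) _ eps1.
exists k.+1%:R => //.
have -> : normal_prob 0 1 (~` F k) = (1 - nu (F k))%E by exact: (@probability_setC _ _ _ nu (F k) (mF k)).
have <- : (fine (nu (F k)))%:E = nu (F k) by apply: fineK; exact: (fin_num_measure nu (F k) (mF k)).
by rewrite -EFinB lee_fin lerBlDr addrC -lerBlDr ltW.
Qed.

End StdNormal.

(** * Small-ball estimates by gridding *)

Section SmallBall.
Context {d} {T : measurableType d} {R : realType} (P : probability T R).
Context {I : finType} (Y : I -> T -> R).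
Hypothesis mY : forall i, measurable_fun setT (Y i).
Hypothesis lawY : forall i (B : set R), measurable B ->
  P (Y i @^-1` B) = normal_prob 0 1 B.
Hypothesis indY : forall B : I -> set R, (forall i, measurable (B i)) ->
  P (\bigcap_(i in [set: I]) (Y i @^-1` B i)) = (\prod_i P (Y i @^-1` B i))%E.

Let mpreim i (B : set R) : measurable B -> measurable (Y i @^-1` B).
Proof. by move=> mB; rewrite -[X in measurable X]setTI; exact: mY. Qed.

(* Gridding [-K, K[ turns the small-ball event for the sum into a finite union
   of product events, on each of which the dominant variable Y i is confined to
   an interval of length 4 * delta. *)
Lemma small_ball_cover (w : I -> R) (i : I) (K delta : R) :
  0 < K -> 0 < delta -> w i != 0 -> (forall k, `|w k| <= `|w i|) ->
  exists E, [/\ measurable E,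
    (P E <= (normal_peak (1 : R) * (4 * delta))%:E)%E &
    forall t, (forall k, - K <= Y k t < K) ->
      `|\sum_k w k * Y k t| < delta * `|w i| -> E t].
Proof.
move=> K0 delta0 wi0 wle.
pose nI : R := #|I|%:R.
(* The mesh is so fine that rounding all the variables costs at most delta in total. *)
pose N := Num.bound (nI * (2 * K) / delta).
pose eta : R := 2 * K / N.+1%:R.
have eta0 : 0 < eta by rewrite divr_gt0// mulr_gt0.
have nI_eta : nI * eta <= delta.
  rewrite /eta mulrA ler_pdivrMr// -ler_pdivrMl// mulrC.
  apply/ltW; apply: lt_le_trans (_ : N%:R <= _); last by rewrite ler_nat.
  by apply: archi_boundP; rewrite divr_ge0 ?mulr_ge0 ?ler0n// ltW.
pose x (m : 'I_N.+1) : R := - K + m%:R * eta.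
pose cell m : set R := `[x m, x m + eta[%classic.
have cellP (y : R) : - K <= y < K -> exists m, cell m y.
  move=> /andP[Ky yK]; have y0 : 0 <= (y + K) / eta.
    by rewrite divr_ge0 ?(ltW eta0)//; lra.
  have /andP[h1 h2] := truncn_itv y0.
  have mN : (Num.truncn ((y + K) / eta) < N.+1)%N.
    rewrite -(ltr_nat R); apply: le_lt_trans h1 _.
    rewrite ltr_pdivrMr// /eta mulrCA divff ?pnatr_eq0// mulr1; lra.
  exists (Ordinal mN); rewrite /cell /= in_itv /= /x /=.
  move: h1 h2; set m := Num.truncn _; rewrite ler_pdivlMr// ltr_pdivrMr//.
  by rewrite -[m.+1%:R]natr1 mulrDl mul1r => h1 h2; apply/andP; split; lra.
(* After division by [w i], [c f] is the contribution of the other variables rounded to the left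
   ends of their cells. The half-width 2 delta of [J f] pays delta for the small ball and delta for
   the rounding. *)
pose c (f : {ffun I -> 'I_N.+1}) := \sum_(k | k != i) w k / w i * x (f k).
pose J f : set R := `[- c f - 2 * delta, - c f + 2 * delta]%classic.
pose B (f : {ffun I -> 'I_N.+1}) k := if k == i then J f else cell (f k).
have mB f k : measurable (B f k) by rewrite /B; case: ifP => _; exact: measurable_itv.
have mcell m : measurable (cell m) by exact: measurable_itv.
have mJ f : measurable (J f) by exact: measurable_itv.
(* Coordinate i is confined by [J f] instead of a cell, so [f i] is pinned to [ord0] to list each
   product event once. *)
pose E := \big[setU/set0]_(f : {ffun I -> 'I_N.+1} | f i == ord0) \bigcap_(k in [set: I]) (Y k @^-1` B f k).
have mcap f : measurable (\bigcap_(k in [set: I]) (Y k @^-1` B f k)).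
  by apply: fin_bigcap_measurable => // k _; exact: mpreim.
exists E; split.
- exact: bigsetU_measurable.
- apply: le_trans (measure_bigsetU_le P _ _ mcap) _.
  pose p k (A : set R) : R := fine (P (Y k @^-1` A)).
  have pE k A : measurable A -> P (Y k @^-1` A) = (p k A)%:E.
    by move=> mA; rewrite /p fineK//; apply: fin_num_measure; exact: mpreim.
  have p0 k A : 0 <= p k A by exact: fine_ge0.
  under eq_bigr do rewrite indY//.
  under eq_bigr do (under eq_bigr do rewrite pE//; rewrite prodEFin).
  rewrite sumEFin lee_fin.
  pose q := normal_peak (1 : R) * (4 * delta).
  have q0 : 0 <= q by rewrite !mulr_ge0 ?normal_peak_ge0// ltW.
  (* Giving weight q to [ord0] and 0 elsewhere at coordinate i encodes the constraint on f, so that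
     the sum over all f factors into a product of sums. *)
  pose F k (m : 'I_N.+1) := if k == i then (if m == ord0 then q else 0)
                            else p k (cell m).
  have F0 k m : 0 <= F k m by rewrite /F; case: ifP => // _; case: ifP.
  apply: (@le_trans _ _ (\sum_(f : {ffun I -> 'I_N.+1}) \prod_k F k (f k))).
    rewrite big_mkcond /=; apply: ler_sum => f _.
    case: ifPn => [/eqP fi|_]; last by apply: prodr_ge0 => k _.
    apply: ler_prod => k _; rewrite p0 /= /B /F.
    case: eqP => [->|//]; rewrite fi eqxx -lee_fin -pE//.
    rewrite lawY//; apply: (le_trans (normal_prob_itv (- c f - 2 * delta) (- c f + 2 * delta) _)); first by lra.
    by rewrite lee_fin /q; apply: ler_wpM2l; rewrite ?normal_peak_ge0//; lra.
  have -> : \sum_(f : {ffun I -> 'I_N.+1}) \prod_k F k (f k) =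
      \prod_k \sum_m F k m by rewrite bigA_distr_bigA.
  rewrite (bigD1 i)//=.
  have -> : \sum_j F i j = q.
    rewrite (bigD1 ord0)//= big1 ?addr0; first by rewrite /F !eqxx.
    by move=> m m0; rewrite /F eqxx (negbTE m0).
  (* Each other factor sums the probabilities of disjoint cells, hence is at most 1. *)
  rewrite ler_piMr//; apply: prodr_ile1 => k ki.
  rewrite sumr_ge0 //=.
  rewrite -lee_fin -sumEFin.
  rewrite (eq_bigr (fun m => P (Y k @^-1` cell m))); last first.
    by move=> m _; rewrite /F (negbTE ki) pE.
  have trivc : trivIset setT (fun m => Y k @^-1` cell m).
    have xlt (m m' : 'I_N.+1) : (m < m')%N -> x m + eta <= x m'.
      move=> mm'; rewrite /x -addrA lerD2l -{2}[eta]mul1r -mulrDl natr1.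
      by rewrite ler_pM2r// ler_nat.
    apply/trivIsetP => m m' _ _ mm'; rewrite -subset0 => t [].
    rewrite /cell /= !in_itv /= => /andP[a1 a2] /andP[b1 b2].
    by move: mm'; rewrite neq_ltn => /orP[/xlt|/xlt] h; lra.
  rewrite -measure_bigsetU_ord//; last by move=> m; exact: mpreim.
  by apply: probability_le1; apply: bigsetU_measurable => m _; exact: mpreim.
- move=> t Yt St.
  have /choice[g gP] : forall k, exists m, cell m (Y k t).
    by move=> k; apply: cellP.
  pose f := [ffun k => if k == i then ord0 else g k].
  rewrite /E (bigD1 f) ?ffunE ?eqxx//=; left => k _ /=.
  rewrite /B; case: eqP => [-> {k}|/eqP ki]; last by rewrite ffunE (negbTE ki).
  have wi_gt0 : 0 < `|w i| by rewrite normr_gt0.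
  pose s := \sum_(k | k != i) w k / w i * Y k t.
  have Ys : `|Y i t + s| < delta.
    rewrite -(ltr_pM2r wi_gt0) -normrM mulrDl mulr_suml mulrC.
    move: St; rewrite (bigD1 i)//=.
    by under [in X in _ -> X]eq_bigr do rewrite mulrAC divfK//.
  (* Each rounding error is at most eta and, by maximality of |w i|, each ratio w k / w i has
     modulus at most 1. *)
  have cs : `|c f - s| <= delta.
    apply: le_trans nI_eta; rewrite -sumrB.
    apply: (@le_trans _ _ (\sum_(k | k != i) eta)).
      apply: le_trans (ler_norm_sum _ _ _) _; apply: ler_sum => k ki.
      rewrite -mulrBr normrM -[leRHS]mul1r; apply: ler_pM => //.
        by rewrite normrM normfV ler_pdivrMr// mul1r.
      move: (gP k); rewrite ffunE (negbTE ki) /cell /= in_itv /= => /andP[a1 a2].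
      by rewrite ler_norml; apply/andP; split; lra.
    rewrite big_mkcond /= /nI -sumr_const mulr_suml; apply: ler_sum => k _.
    by rewrite mul1r; case: ifP => // _; exact: ltW.
  move: Ys cs; rewrite ltr_norml ler_norml => /andP[a1 a2] /andP[b1 b2].
  by rewrite /J /= in_itv /=; apply/andP; split; lra.
Qed.

(** The largest weight satisfies |w i|^2 >= (sum of w_k^2)/#|I|, so a small-ball bound at scale |w
    i| has constants independent of w. Half of eps pays for the tails, half for the small ball. *)
Lemma anticoncentration (eps : R) : (0 < #|I|)%N -> 0 < eps ->
  exists c K : R, [/\ 0 < c, 0 < K & forall w : I -> R, exists E,
    [/\ measurable E, (P E <= eps%:E)%E & forall t, ~ E t ->
      (forall i, Y i t ^+ 2 <= K) /\
      c * (\sum_i w i ^+ 2) <= (\sum_i w i * Y i t) ^+ 2]].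
Proof.
move=> cardI eps0; have /card_gt0P[i0 _] := cardI.
pose nI : R := #|I|%:R; have nI0 : 0 < nI by rewrite ltr0n.
have eps_nI : 0 < eps / 2 / nI by rewrite !divr_gt0.
have [K K0 tailK] := normal_prob_tail _ eps_nI.
have peak0 : 0 < normal_peak (1 : R) by rewrite normal_peak_gt0 ?oner_neq0.
(* Chosen so that the small-ball bound, peak times 4 delta, equals eps/2. *)
pose delta := eps / (8 * normal_peak (1 : R)).
have delta0 : 0 < delta by rewrite divr_gt0// mulr_gt0.
have c0 : 0 < delta ^+ 2 / nI by rewrite divr_gt0// exprn_gt0.
exists (delta ^+ 2 / nI), (K ^+ 2); split=> [//||w]; first by rewrite exprn_gt0.
pose i := [arg max_(k > i0) `|w k|]%O.
have wi k : `|w k| <= `|w i|.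
  by rewrite /i; case: (@Order.TotalTheory.arg_maxP _ R I i0 xpredT (fun k => `|w k|)) => // j _; exact.
have [E1 [mE1 PE1 E1P]] : exists E1, [/\ measurable E1, (P E1 <= (eps / 2)%:E)%E &
    forall t, (forall k, - K <= Y k t < K) ->
      `|\sum_k w k * Y k t| < delta * `|w i| -> E1 t].
  (* If the maximal weight is 0, the strict inequality is impossible and the empty event serves. *)
  have [wi0|wi0] := eqVneq (w i) 0.
    exists set0; split=> [//||t _]; first by rewrite measure0 lee_fin divr_ge0// ltW.
    by rewrite wi0 normr0 mulr0 normr_lt0.
  have [E1 [mE1 PE1 E1P]] := small_ball_cover w i K delta K0 delta0 wi0 wi.
  exists E1; split=> //; suff -> : eps / 2 = normal_peak (1 : R) * (4 * delta) by [].
  by rewrite /delta; field; rewrite gt_eqF.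
pose tail k := Y k @^-1` (~` `[- K, K[%classic).
have mtail k : measurable (tail k).
  by apply: mpreim; apply: measurableC; exact: measurable_itv.
exists (E1 `|` \big[setU/set0]_k tail k); split.
- by apply: measurableU => //; exact: bigsetU_measurable.
- apply: le_trans (measureU2 P mE1 _) _; first exact: bigsetU_measurable.
  rewrite (_ : eps = eps / 2 + eps / 2); last by rewrite -splitr.
  rewrite EFinD; apply: leeD => //.
  apply: le_trans (measure_bigsetU_le P _ _ mtail) _.
  apply: (@le_trans _ _ (\sum_(k : I) (eps / 2 / nI)%:E)%E).
    apply: lee_sum => k _; rewrite lawY//.
    by apply: measurableC; exact: measurable_itv.
  by rewrite sumEFin lee_fin sumr_const -[leLHS]mulr_natr divfK// gt_eqF.
- move=> t /not_orP[nE1 ntail].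
  have YK k : - K <= Y k t < K.
    apply: contrapT => nk; apply: ntail; rewrite (bigD1 k)//=; left.
    by rewrite /tail /= in_itv.
  split=> [k|].
    rewrite -real_normK ?num_real// lerXn2r ?nnegrE ?(ltW K0)//.
    by move: (YK k) => /andP[a1 a2]; rewrite ler_norml a1 ltW.
  have : delta * `|w i| <= `|\sum_k w k * Y k t|.
    by rewrite leNgt; apply/negP => /(E1P t YK).
  have lhs0 : 0 <= delta * `|w i| by rewrite mulr_ge0// ltW.
  rewrite -(ler_pXn2r (_ : 0 < 2)%N) ?nnegrE// exprMn !real_normK ?num_real//.
  apply: le_trans; rewrite -mulrA ler_wpM2l ?sqr_ge0// ler_pdivrMl//.
  rewrite /nI -sumr_const mulr_suml; apply: ler_sum => k _.
  rewrite mul1r -(real_normK (num_real (w k))) -(real_normK (num_real (w i))).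
  by rewrite lerXn2r ?nnegrE.
Qed.

End SmallBall.

(** * Expectations off an exceptional event *)

Lemma cvge0_le {R : realType} (f : nat -> \bar R) : (forall k, (0 <= f k)%E) ->
  (forall eps : R, 0 < eps -> \forall k \near \oo, (f k <= eps%:E)%E) ->
  f @ \oo --> 0%E.
Proof.
move=> f0 fle; apply/fine_cvgP; split.
  near=> k; rewrite ge0_fin_numE//; apply: le_lt_trans (ltry 1).
  by near: k; exact: fle.
apply/cvgr0Pnorm_le => eps eps0; near=> k.
have fk : (f k <= eps%:E)%E by near: k; exact: fle.
have fin : f k \is a fin_num by rewrite ge0_fin_numE//; exact: le_lt_trans (ltry eps).
by rewrite /= ger0_norm ?fine_ge0// -lee_fin fineK.
Unshelve. all: by end_near. Qed.

Section Expectation.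
Context {R : realType} {n C : nat} {d} {T : measurableType d} (P : probability T R).
Context (Z : 'I_n -> 'I_C -> T -> R).
Hypothesis HZ : std_gaussian_family P Z.

Let mZ i j : measurable_fun setT (Z i j). Proof. by case: HZ. Qed.

Lemma measurable_frob2_Zmat {m} (M : 'M[R]_(m, n)) :
  measurable_fun setT (fun t => frob2 (M *m Zmat Z t)).
Proof.
apply: measurable_sum => i; apply: measurable_sum => j; apply: measurable_funX.
under eq_fun do rewrite mxE.
apply: measurable_sum => k; apply: measurable_funM => //.
by under eq_fun do rewrite mxE; exact: mZ.
Qed.

Lemma measurable_Dir_Zmat (e : rel 'I_n) (e_sym : symmetric e) (M : 'M[R]_n) :
  measurable_fun setT (fun t => Dir e (M *m Zmat Z t)).
Proof.
have DE t : Dir e (M *m Zmat Z t) =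
    2^-1 * \sum_i \sum_j frob2 (edge_row e i j *m M *m Zmat Z t).
  under eq_bigr do under eq_bigr do rewrite -mulmxA.
  by rewrite -Dir_edges// -[Dir _ _ *+ 2]mulr_natl mulKf.
under eq_fun do rewrite DE.
apply: measurable_funM => //; apply: measurable_sum => i; apply: measurable_sum => j.
exact: measurable_frob2_Zmat.
Qed.

(** A single column already bounds |v Z|^2 from below, so anticoncentration is applied to one linear
    form in all entries of Z, with weights supported on column [j0]. *)
Lemma Zmat_good_event (eps : R) : (0 < n)%N -> (0 < C)%N -> 0 < eps ->
  exists c K : R, [/\ 0 < c, 0 < K & forall v : 'rV[R]_n, exists E,
    [/\ measurable E, (P E <= eps%:E)%E & forall t, ~ E t ->
      frob2 (Zmat Z t) <= K /\ c * frob2 v <= frob2 (v *m Zmat Z t)]].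
Proof.
move=> n0 C0 eps0; have [_ [lawZ indZ]] := HZ.
pose Y (k : 'I_n * 'I_C) := Z k.1 k.2.
have mY k : measurable_fun setT (Y k) by exact: mZ.
have lawY k (B : set R) : measurable B -> P (Y k @^-1` B) = normal_prob 0 1 B.
  by move=> mB; exact: lawZ.
have indY (B : 'I_n * 'I_C -> set R) : (forall k, measurable (B k)) ->
    P (\bigcap_(k in [set: 'I_n * 'I_C]) (Y k @^-1` B k)) =
    (\prod_k P (Y k @^-1` B k))%E.
  move=> mB; have := indZ (fun i j => B (i, j)) (fun i j => mB (i, j)).
  by under eq_bigcapr do rewrite -surjective_pairing;
    under eq_bigr do rewrite -surjective_pairing.
have cardI : (0 < #|{: 'I_n * 'I_C}|)%N by rewrite card_prod !card_ord muln_gt0 n0.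
have [c [K [c0 K0 H]]] := anticoncentration P Y mY lawY indY eps cardI eps0.
exists c, (K * (n * C)%:R); split=> [//||v].
  by rewrite mulr_gt0// ltr0n muln_gt0 n0.
have j0 : 'I_C := Ordinal C0.
have [E [mE PE EP]] := H (fun k => v 0 k.1 * (k.2 == j0)%:R).
exists E; split=> // t /EP[YK YS]; split.
  rewrite /frob2 pair_bigA /=.
  apply: (@le_trans _ _ (\sum_(k : 'I_n * 'I_C) K)).
    by apply: ler_sum => k _; rewrite mxE; exact: YK.
  by rewrite sumr_const card_prod !card_ord mulr_natr.
have sum0 (F : 'I_n -> 'I_C -> R) :
    \sum_(k : 'I_n * 'I_C) F k.1 k.2 * (k.2 == j0)%:R = \sum_i F i j0.
  rewrite -(pair_bigA _ (fun i j => F i j * (j == j0)%:R)) /=.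
  apply: eq_bigr => i _; rewrite (bigD1 j0)//= eqxx mulr1 big1 ?addr0// => j jj0.
  by rewrite (negbTE jj0) mulr0.
apply: le_trans (sqr_le_frob2 _ 0 j0).
rewrite mxE [X in _ <= X ^+ 2](eq_bigr (fun i => v 0 i * Z i j0 t)); last first.
  by move=> i _; rewrite mxE.
rewrite /frob2 big_ord1 -(sum0 (fun i j => v 0 i * Z i j t)) -(sum0 (fun i j => v 0 i ^+ 2)).
have -> : \sum_(k : 'I_n * 'I_C) v 0 k.1 ^+ 2 * (k.2 == j0)%:R =
    \sum_(k : 'I_n * 'I_C) (v 0 k.1 * (k.2 == j0)%:R) ^+ 2.
  by apply: eq_bigr => k _; rewrite exprMn; case: (_ == _); rewrite ?expr1n ?expr0n.
apply: le_trans YS _; rewrite (eq_bigr (fun k => v 0 k.1 * Z k.1 k.2 t * (k.2 == j0)%:R))//.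
by move=> k _; rewrite mulrAC.
Qed.

(** Integrates X >= m 1_{~E}. *)
Lemma expectation_ge_off (X : T -> R) (E : set T) (m : R) :
  measurable_fun setT X -> measurable E -> (forall t, 0 <= X t) -> 0 <= m ->
  (forall t, ~ E t -> m <= X t) -> (m%:E * (1 - P E) <= 'E_P[X])%E.
Proof.
move=> mX mE X0 m0 mXE; have mEC : measurable (~` E) by exact: measurableC.
rewrite unlock -probability_setC//.
rewrite -[X in (_ * P X <= _)%E]setTI setIC -integral_indic// -ge0_integralZl//; last first.
  by apply/measurable_EFinP; exact: measurable_indic.
apply: ge0_le_integral => //.
- by move=> t _; rewrite -EFinM lee_fin mulr_ge0.
- by apply/measurable_EFinP; apply: measurable_funM => //; exact: measurable_indic.
- exact/measurable_EFinP.
- move=> t _; rewrite -EFinM lee_fin indicE.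
  case: (boolP (t \in ~` E)) => [|_]; last by rewrite mulr0.
  by rewrite mulr1 inE => /mXE.
Qed.

(** Integrates X <= m + M 1_E. *)
Lemma expectation_le_off (X : T -> R) (E : set T) (m M : R) :
  measurable_fun setT X -> measurable E -> (forall t, 0 <= X t <= M) ->
  0 <= m -> 0 <= M ->
  (forall t, ~ E t -> X t <= m) -> ('E_P[X] <= m%:E + M%:E * P E)%E.
Proof.
move=> mX mE X0 m0 M0 mXE.
rewrite unlock -[X in (_ <= _ + _ * P X)%E]setTI setIC -integral_indic//.
have mI : measurable_fun setT (fun t => (\1_E t : R)%:E).
  by apply/measurable_EFinP; exact: measurable_indic.
rewrite -ge0_integralZl//.
have -> : m%:E = (\int[P]_(t in setT) (cst m%:E) t)%E.
  by rewrite integral_cst//= probability_setT mule1.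
rewrite -ge0_integralD//; last 2 first.
- by move=> t _; rewrite -EFinM lee_fin mulr_ge0.
- by apply/measurable_EFinP; apply: measurable_funM => //; exact: measurable_indic.
apply: ge0_le_integral => //.
- by move=> t _; rewrite lee_fin; case/andP: (X0 t).
- exact/measurable_EFinP.
- by apply/measurable_EFinP; apply: measurable_funD => //; apply: measurable_funM => //; exact: measurable_indic.
- move=> t _; rewrite /= -EFinM -EFinD lee_fin indicE.
  have /andP[_ XM] := X0 t.
  case: (boolP (t \in E)) => [_|].
    by rewrite mulr1 (le_trans XM)// lerDr.
  by rewrite mulr0 addr0 notin_setE => /mXE.
Qed.

End Expectation.

(** * Limits *)

Section Limits.
Context {R : realType} {n C : nat} {d} {T : measurableType d} (P : probability T R).
Context (Z : 'I_n -> 'I_C -> T -> R) (HZ : std_gaussian_family P Z).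
Context (e : rel 'I_n) (e_sym : symmetric e) (n_gt0 : (0 < n)%N) (C_gt0 : (0 < C)%N).
Variables (a b : R) (G : nat -> 'M[R]_n) (u : 'cV[R]_n).
Hypotheses (a_gt0 : 0 < a) (b_ge0 : 0 <= b) (ab_gt1 : 1 < a + b).
Hypothesis G_rec : forall k, G k.+1 *m (G k.+1)^T =
  a *: (Ahat e *m (G k *m (G k)^T) *m Ahat e) + b *: (G k *m (G k)^T).
Hypotheses (u_neq0 : u != 0) (Au : Ahat e *m u = u) (uG_neq0 : 0 < frob2 (u^T *m G 0%N)).

Let rho := a + b.
Let rho_gt0 : 0 < rho. Proof. by rewrite /rho ltr_pwDl. Qed.

(** Apply the good event to v = u^T G_k, whose squared norm grows like rho^k, and pass to G_k Z by
    submultiplicativity. Only the exceptional event depends on k, not c or K. *)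
Lemma frob2_lower (eps : R) : 0 < eps ->
  exists c K : R, [/\ 0 < c, 0 < K & forall k, exists E,
    [/\ measurable E, (P E <= eps%:E)%E & forall t, ~ E t ->
      frob2 (Zmat Z t) <= K /\ c * rho ^+ k <= frob2 (G k *m Zmat Z t)]].
Proof.
move=> eps0; have [c [K [c0 K0 H]]] := Zmat_good_event P Z HZ eps n_gt0 C_gt0 eps0.
have u0 := frob2_gt0 u u_neq0.
exists (c * frob2 (u^T *m G 0%N) / frob2 u), K; split=> // [|k].
  by rewrite divr_gt0// mulr_gt0.
have [E [mE PE EP]] := H (u^T *m G k).
exists E; split=> // t /EP[ZK uZ]; split=> //.
have := frob2M u^T (G k *m Zmat Z t); rewrite frob2_tr mulmxA => uM.
rewrite mulrAC ler_pdivrMr// [leRHS]mulrC; apply: le_trans uM; apply: le_trans uZ.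
by rewrite (frob2_eigen e e_sym a b G G_rec u k Au) -/rho [leRHS]mulrA [leLHS]mulrAC.
Qed.

Lemma FSP_cvg {d0} (X : 'M[R]_(n, d0)) : X != 0 ->
  (fun k => FSP P Z (G k) X) @ \oo --> +oo%E.
Proof.
move=> /frob2_gt0 X0.
have [c [K [c0 K0 H]]] := frob2_lower 2^-1 ltac:(by rewrite invr_gt0).
have rho_oo : (fun k => rho ^+ k) @ \oo --> +oo%R.
  have rhoV : (fun k => (rho ^+ k)^-1) @ \oo --> (0 : R).
    under eq_fun do rewrite -exprVn.
    by apply: cvg_expr; rewrite ger0_norm ?invr_ge0 ?ltW// invf_lt1.
  by apply/gtr0_cvgV0; [near=> k; rewrite exprn_gt0|exact: rhoV].
apply/cvgeyPge => A.
(* Half the mass lies off the exceptional event, so the expectation is at least c rho^k / (2 |X|^2);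
   this threshold makes that at least A. *)
have /cvgryPge/(_ (A * 2 * frob2 X / c)) := rho_oo.
apply: filterS => k rhok.
have [E [mE PE EP]] := H k.
have low : 0 <= c * rho ^+ k / frob2 X by rewrite !mulr_ge0 ?invr_ge0 ?exprn_ge0// ltW.
have := @expectation_ge_off R d T P (fun t => frob2 (G k *m Zmat Z t) / frob2 X) E
  (c * rho ^+ k / frob2 X).
rewrite /FSP => /(_ _ mE _ low) ge.
apply: le_trans (ge _ _ _); last first.
- by move=> t /EP[_]; rewrite ler_pM2r// invr_gt0.
- by move=> t; rewrite divr_ge0 ?frob2_ge0.
- by apply: measurable_funM => //; exact: (measurable_frob2_Zmat P).
have : (2^-1%:E <= 1 - P E)%E.
  have <- : (fine (P E))%:E = P E by apply: fineK; exact: fin_num_measure.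
  rewrite -EFinB lee_fin.
  have : fine (P E) <= 2^-1 by rewrite -lee_fin fineK//; exact: fin_num_measure.
  lra.
move=> /(lee_wpmul2l _) h; apply: le_trans (h _ _); last by rewrite lee_fin.
rewrite -EFinM lee_fin.
move: rhok; rewrite ler_pdivrMr// => rhok.
by rewrite ler_pdivlMr// ler_pdivlMr// [leRHS]mulrC.
Unshelve. all: by end_near. Qed.

Lemma GEV_cvg : (fun k => GEV e P Z (G k)) @ \oo --> 0%E.
Proof.
have Dir_le2 m (H : 'M[R]_(n, m)) : Dir e H <= 2 * frob2 H.
  apply: le_trans (Dir_le e e_sym H) _; rewrite ler_wpM2r ?frob2_ge0//.
  by rewrite gerBl divr_ge0// addr_ge0.
have ratio_ge0 k t : 0 <= Dir e (G k *m Zmat Z t) / frob2 (G k *m Zmat Z t).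
  by rewrite divr_ge0 ?Dir_ge0 ?frob2_ge0.
apply: cvge0_le => [k|eps eps0].
  by rewrite /GEV expectation_ge0.
(* The exceptional event costs at most 2 (eps/4). Off it the ratio is at most Dir(G_k) K / (c
   rho^k), which the threshold eps/2 * c / K brings below eps/2. *)
have eps4 : 0 < eps / 4 by rewrite divr_gt0.
have [c [K [c0 K0 H]]] := frob2_lower _ eps4.
have eps' : 0 < eps / 2 * c / K by rewrite divr_gt0// mulr_gt0// divr_gt0.
have /cvgr0Pnorm_le/(_ _ eps') :=
  Dir_negligible e e_sym a b G a_gt0 b_ge0 G_rec n_gt0.
apply: filterS => k; rewrite -/rho => Dk.
have [E [mE PE EP]] := H k.
have mratio : measurable_fun setT
    (fun t => Dir e (G k *m Zmat Z t) / frob2 (G k *m Zmat Z t)).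
  (* On nonnegative reals the inverse, 0 at 0 included, is the real power -1, which is
     measurable. *)
  under eq_fun do rewrite -powR_inv1 ?frob2_ge0//.
  apply: measurable_funM; first exact: (measurable_Dir_Zmat P).
  exact: (measurableT_comp (measurable_powR (-1)) (measurable_frob2_Zmat P Z HZ (G k))).
apply: (@le_trans _ _ ((eps / 2)%:E + 2%:E * P E)%E); last first.
  have : (2%:E * P E <= 2%:E * (eps / 4)%:E)%E by apply: lee_wpmul2l.
  move=> /(leeD2l (eps / 2)%:E) h; apply: le_trans h _.
  by rewrite -EFinM -EFinD lee_fin; lra.
apply: expectation_le_off => //.
- move=> t; rewrite ratio_ge0 /=.
  (* Where the norm vanishes, division by zero gives ratio 0. *)
  have [->|H0] := eqVneq (frob2 (G k *m Zmat Z t)) 0; first by rewrite invr0 mulr0.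
  by rewrite ler_pdivrMr// lt_def H0 frob2_ge0.
- by rewrite divr_ge0// ltW.
move=> t /EP[ZK HK].
have HK0 : 0 < c * rho ^+ k by rewrite mulr_gt0// exprn_gt0.
rewrite ler_pdivrMr; last exact: lt_le_trans HK.
apply: (@le_trans _ _ (eps / 2 * (c * rho ^+ k))); last first.
  by rewrite ler_wpM2l// divr_ge0// ltW.
apply: le_trans (DirM e e_sym _ _) _.
apply: (@le_trans _ _ (Dir e (G k) * K)).
  by rewrite ler_wpM2l ?Dir_ge0.
move: Dk; rewrite ger0_norm ?divr_ge0 ?Dir_ge0 ?exprn_ge0 ?(ltW rho_gt0)//.
by rewrite ler_pdivrMr ?exprn_gt0// mulrAC ler_pdivlMr// (mulrA (eps / 2)).
Qed.

End Limits.

(** * Specialization to the residual GCN covariances *)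

Theorem theorem3 (R : realType) (n d0 C : nat) (e : rel 'I_n)
  (e_sym : symmetric e) (e_irr : irreflexive e)
  (X : 'M[R]_(n, d0)) (HX : X != 0) (HC : (0 < C)%N)
  (alpha beta sw2 : R) (Hsw : 0 < sw2) (Ha : alpha != 0)
  (Hab : 1 < alpha ^+ 2 * sw2 + beta ^+ 2)
  (u : 'cV[R]_n) (Hu0 : u != 0) (Hu : Ahat e *m u = u) (HXu : X^T *m u != 0)
  (dT : measure_display) (T : measurableType dT) (P : probability T R)
  (Z : 'I_n -> 'I_C -> T -> R) (HZ : std_gaussian_family P Z)
  (S : nat -> 'M[R]_n)
  (HS : forall L, S L *m (S L)^T = Sigma e X alpha beta sw2 L) :
  ((fun L => FSP P Z (S L) X) @ \oo --> +oo%E) /\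
  ((fun L => GEV e P Z (S L)) @ \oo --> 0%E).
Proof.
have a0 : 0 < alpha ^+ 2 * sw2 by rewrite mulr_gt0// exprn_even_gt0.
have b0 : 0 <= beta ^+ 2 by exact: sqr_ge0.
have n0 : (0 < n)%N by have /matrix0Pn[[i ilt] _] := HX; case: (n) ilt.
have d00 : (0 < d0)%N by have /matrix0Pn[_ [[j jlt] _]] := HX; case: (d0) jlt.
(* The recursion starts at L = 1, since [Sigma] takes the same value at 0 and 1; the shift does not
   affect the limits. *)
pose G k := S k.+1.
have Grec k : G k.+1 *m (G k.+1)^T =
    (alpha ^+ 2 * sw2) *: (Ahat e *m (G k *m (G k)^T) *m Ahat e)
    + (beta ^+ 2) *: (G k *m (G k)^T) by rewrite /G !HS.
(* Because u is fixed by Ahat, this quantity is (sw2^2 / d0) |X^T u|^2, which is positive by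
   [HXu]. *)
have uG : 0 < frob2 (u^T *m G 0%N).
  rewrite frob2E trmx_mul trmxK -mulmxA (mulmxA (G 0%N)) /G HS /Sigma /=.
  rewrite -scalemxAl -scalemxAr mxtraceZ mulr_gt0//.
    by rewrite divr_gt0 ?exprn_gt0// ltr0n.
  have -> : u^T *m (Ahat e *m X *m X^T *m Ahat e *m u) = (X^T *m u)^T *m (X^T *m u).
    have uA : u^T *m Ahat e = u^T by rewrite -{1}(Ahat_sym e e_sym) -trmx_mul Hu.
    move: (Ahat e) Hu uA => A Au uA.
    by rewrite trmx_mul trmxK -!mulmxA Au !mulmxA uA.
  by rewrite -{2}[X^T *m u]trmxK -frob2E frob2_tr frob2_gt0.
by split; [rewrite -(cvg_shiftS (fun L => FSP P Z (S L) X))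
          |rewrite -(cvg_shiftS (fun L => GEV e P Z (S L)))];
  [exact: (FSP_cvg P Z HZ e e_sym n0 HC _ _ G u a0 b0)
  |exact: (GEV_cvg P Z HZ e e_sym n0 HC _ _ G u a0 b0)].
Qed.
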